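(* Let $\Omega_x\subset\mathbb{R}$ be a bounded open interval, let $a\in C^\infty(\overline{\Omega_x})$ with $a(x)\ge\alpha_0>0$, and let $\{\phi_k\}_{k\ge1}$ be an orthonormal basis of $L^2(\Omega_x)$ consisting of Dirichlet eigenfunctions of $\mathcal{L}=-\partial_x(a(x)\partial_x\,\cdot\,)$, i.e. $\mathcal{L}\phi_k=\lambda_k\phi_k$, $\phi_k|_{\partial\Omega_x}=0$, with $0<\lambda_1\le\lambda_2\le\cdots$, $\lambda_k\to\infty$. Let $T>0$ and let $u_T\in H^s(\Omega_x)$ have only finitely many nonzero coefficients $\alpha_k(T)=\int_{\Omega_x}u_T\phi_k\,dx$. Let $$u(t,x)=\sum_{k\ge1}\alpha_k(t)\phi_k(x),\qquad \alpha_k(t)=e^{\lambda_k(T-t)}\alpha_k(T),\qquad 0\le t\le T,$$ be the solution of the backward problem $\partial_tu=\partial_x(a(x)\partial_xu)$ in $\Omega_x$, $0<t<T$, with homogeneous Dirichlet boundary condition and $u(T,\cdot)=u_T$. For a positive integer $n_{\max}$ let $$\delta(n_{\max})=\Big(\sum_{k=n_{\max}}^\infty|\alpha_k(0)|^2\lambda_k^s\Big)^{1/2},\qquad w_{n_{\max}}(t,x,p)=\sum_{1\le k\le n_{\max}}e^{-|p-\lambda_k(T-t)|}\alpha_k(T)\phi_k(x),$$ and define $u_{n_{\max}}(t,x,p)$ by either one of the formulas $$u_{n_{\max}}=e^{p}\,w_{n_{\max}}(t,x,p)\qquad\text{or}\qquad u_{n_{\max}}=e^{p}\int_p^\infty w_{n_{\max}}(t,x,q)\,dq,$$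 where $p>p^{\Diamond}=\lambda_{n_{\max}}T$. Let $\varepsilon>0$ and suppose $n_{\max}$ is chosen such that $\delta(n_{\max})/\lambda_{n_{\max}}^{s/2}\le\varepsilon$. Then for all $0\le t<T$ and all $p>p^{\Diamond}$, $$\|u(t,\cdot)-u_{n_{\max}}(t,\cdot,p)\|_{L^2(\Omega_x)}\le \frac{e^{-\lambda_{n_{\max}}t}\,\delta(n_{\max})}{\lambda_{n_{\max}}^{s/2}}\le\varepsilon .$$
   Context: The $H^s(\Omega_x)$ norm is $\|v\|_{H^s(\Omega_x)}^2=\sum_{k\ge1}|\beta_k|^2(1+\lambda_k+\cdots+\lambda_k^s)$ with $\beta_k=\int_{\Omega_x}v\phi_k\,dx$, for $s$ a nonnegative integer; a noninteger $s\in[1,2]$ is also allowed (then the norm is, up to equivalence, $\sum_k|\beta_k|^2(1+\lambda_k^s)$). For $s=0$ it is the usual $L^2(\Omega_x)$ norm. If the expansion of $u_T$ in the basis is not finite, $u_T$ is first replaced by a finite truncation of its expansion. *)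

(* Defs.v *)
From HB Require Import structures.
From mathcomp Require Import all_boot all_order all_algebra.
From mathcomp Require Import all_classical all_reals all_analysis.
Import Order.TTheory GRing.Theory Num.Theory.
Import numFieldNormedType.Exports.

Set Implicit Arguments.
Unset Strict Implicit.
Unset Printing Implicit Defensive.

Local Open Scope classical_set_scope.
Local Open Scope ring_scope.

(* Throughout, Omega = ]xl, xr[, functions on Omega (or on its closure) are
   total functions R -> R whose values elsewhere are irrelevant, and sequences
   indexed by k >= 1 are functions on nat whose value at 0 is never used. *)

Section L2.
Context {R : realType}.
Implicit Types (xl xr : R) (f g : R -> R).

(* [f \_ A] is f on A and 0 outside A. *)
Definition L2norm xl xr f : \bar R :=
  'N[lebesgue_measure]_2%:E[EFin \o (f \_ `]xl, xr[)]%E.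

Definition inL2 xl xr f : Prop :=
  f \_ `]xl, xr[ \in Lfun (@lebesgue_measure R) 2%:E.

Definition inner xl xr f g : R :=
  \int[lebesgue_measure]_(x in `]xl, xr[) (f x * g x).

Definition orthonormal_basis xl xr (phi : nat -> R -> R) : Prop :=
  [/\ forall k, (1 <= k)%N -> inL2 xl xr (phi k),
      forall j k, (1 <= j)%N -> (1 <= k)%N ->
        inner xl xr (phi j) (phi k) = (j == k)%:R
    & forall f, inL2 xl xr f ->
        L2norm xl xr
          (fun x => f x - \sum_(1 <= k < n.+1) inner xl xr f (phi k) * phi k x)
        @[n --> \oo] --> 0%E].

End L2.

Section Operator.
Context {R : realType}.
Implicit Types (xl xr : R) (a v : R -> R).

(* C^oo of the closed interval: every derivative on the open interval extends
   continuously to the end points. *)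
Definition smooth_closed xl xr a : Prop :=
  [/\ {within `[xl, xr], continuous a},
      forall (n : nat) (x : R), x \in `]xl, xr[ -> derivable (derive1n n a) x 1
    & forall n : nat,
        cvg (derive1n n a x @[x --> xl^'+]) /\ cvg (derive1n n a x @[x --> xr^'-])].

(* d/dx (a(x) dv/dx) *)
Definition diffusion a v : R -> R := derive1 (fun y => a y * derive1 v y).

(* Functions to which the diffusion operator applies classically and which
   satisfy the homogeneous Dirichlet condition. *)
Definition dirichlet_regular xl xr a v : Prop :=
  [/\ {within `[xl, xr], continuous v},
      v xl = 0,
      v xr = 0
    & forall x, x \in `]xl, xr[ ->
        derivable v x 1 /\ derivable (fun y => a y * derive1 v y) x 1].

(* Nontriviality of v is not included; it follows from normalization. *)
Definition dirichlet_eigenfunction xl xr a (l : R) v : Prop :=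
  dirichlet_regular xl xr a v /\
  forall x, x \in `]xl, xr[ -> - diffusion a v x = l * v x.

Definition backward_solution xl xr a (T : R) (uT : R -> R)
    (u : R -> R -> R) : Prop :=
  [/\ forall t, 0 < t < T -> dirichlet_regular xl xr a (u t),
      forall t x, 0 < t < T -> x \in `]xl, xr[ ->
        is_derive t 1 (fun r => u r x) (diffusion a (u t) x),
      forall x, x \in `]xl, xr[ ->
        {within `[0, T], continuous (fun t => u t x)}
    & {ae lebesgue_measure, forall x, x \in `]xl, xr[ -> u T x = uT x}].

End Operator.

Section Sobolev.
Context {R : realType}.
Implicit Types (xl xr s l : R) (v : R -> R).

(* 1 + l + ... + l^s for integer s, 1 + l^s otherwise. *)
Definition Hs_weight s l : R :=
  if s \is a Num.nat then \sum_(0 <= j < (Num.truncn s).+1) l ^+ j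
  else 1 + l `^ s.

Definition Hs_norm xl xr (phi : nat -> R -> R) (lambda : nat -> R) s v
    : \bar R :=
  ((\sum_(1 <= k <oo)
      (`|inner xl xr v (phi k)| ^+ 2 * Hs_weight s (lambda k))%:E)
   `^ 2^-1)%E.

Definition inHs xl xr phi lambda s v : Prop :=
  inL2 xl xr v /\ (Hs_norm xl xr phi lambda s v < +oo)%E.

End Sobolev.

Section Recovery.
Context {R : realType}.
Variables (xl xr : R) (phi : nat -> R -> R) (lambda : nat -> R).
Variables (T : R) (uT : R -> R).

(* alpha_k(t); note that coef T k reduces to inner xl xr uT (phi k) since
   expR 0 = 1. *)
Definition coef (t : R) (k : nat) : R :=
  expR (lambda k * (T - t)) * inner xl xr uT (phi k).

(* The eigenfunction expansion; the value is meaningful when the partial sums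
   converge, in particular when only finitely many coefficients are nonzero. *)
Definition expansion (t x : R) : R :=
  \big[+%R/0]_(1 <= k <oo) (coef t k * phi k x).

Definition delta (s : R) (n : nat) : R :=
  Num.sqrt (\big[+%R/0]_(n <= k <oo) (`|coef 0 k| ^+ 2 * lambda k `^ s)).

Definition warped (n : nat) (t x p : R) : R :=
  \sum_(1 <= k < n.+1)
    expR (- `|p - lambda k * (T - t)|) * inner xl xr uT (phi k) * phi k x.

Definition recover_pointwise (n : nat) (t x p : R) : R :=
  expR p * warped n t x p.

Definition recover_integral (n : nat) (t x p : R) : R :=
  expR p * \int[lebesgue_measure]_(q in `]p, +oo[) warped n t x q.

End Recovery.

(* Main.v *)
(* For p > lambda_nmax T every warped mode is on its decaying side, where
   e^p e^{-|p - mu|} = e^p int_p^oo e^{-|q - mu|} dq = e^mu.  Both recovery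
   formulas therefore return the partial sum of the expansion of u up to nmax,
   and by orthonormality the squared error is the sum over k > nmax of
   e^{-2 lambda_k t} |alpha_k(0)|^2, to be compared termwise with
   e^{-2 lambda_nmax t} |alpha_k(0)|^2 (lambda_k / lambda_nmax)^s. *)
Require Import Defs.
From HB Require Import structures.
From mathcomp Require Import all_boot all_order all_algebra.
From mathcomp Require Import all_classical all_reals all_analysis.
From mathcomp Require Import measurable_realfun.
Import Order.TTheory GRing.Theory Num.Theory.
Import numFieldNormedType.Exports.

Set Implicit Arguments.
Unset Strict Implicit.
Unset Printing Implicit Defensive.

Local Open Scope classical_set_scope.
Local Open Scope ring_scope.

(** Integrability is asked only for indices occurring in [r]: the modes [phi k] are known to be
    square integrable only for k >= 1, and [phi 0] is arbitrary. *)
Lemma Rintegral_sum d (T : measurableType d) (R : realType)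
    (mu : {measure set T -> \bar R}) (D : set T) (I : eqType) (r : seq I)
    (F : I -> T -> R) :
  measurable D ->
  (forall i, i \in r -> mu.-integrable D (EFin \o F i)) ->
  \int[mu]_(x in D) (\sum_(i <- r) F i x) =
  \sum_(i <- r) \int[mu]_(x in D) F i x.
Proof.
move=> mD; elim: r => [_|i r IH intF].
  under eq_Rintegral do rewrite big_nil.
  by rewrite big_nil /Rintegral integral0.
have intr j : j \in r -> mu.-integrable D (EFin \o F j).
  by move=> jr; apply: intF; rewrite inE jr orbT.
under eq_Rintegral do rewrite big_cons.
rewrite big_cons -IH// -RintegralD//; first by apply: intF; rewrite mem_head.
rewrite (_ : _ \o _ = fun x => (\sum_(j <- r | j \in r) (F j x)%:E)%E).
  exact: integrable_sum.
by apply/funext => x /=; rewrite -big_seq sumEFin.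
Qed.

(** * Pythagoras for finite orthonormal combinations *)

Section orthonormal_combination.
Context {R : realType} (xl xr : R).

Lemma inL2_mul_integrable (f g : R -> R) : inL2 xl xr f -> inL2 xl xr g ->
  (@lebesgue_measure R).-integrable `]xl, xr[ (EFin \o (fun x => f x * g x)).
Proof.
move=> f2 g2; rewrite integrable_mkcond//.
have /Lfun1_integrable := Lfun2_mul_Lfun1 f2 g2.
congr integrable; apply/funext => x /=.
by rewrite /patch; case: ifP => //=; rewrite mul0r.
Qed.

(** Integrability makes the extended-real integral of f^2 finite, so passing to the real-valued
    [inner] loses no information. *)
Lemma L2normE (f : R -> R) :
  (@lebesgue_measure R).-integrable `]xl, xr[ (EFin \o (fun x => f x * f x)) ->
  L2norm xl xr f = (Num.sqrt (inner xl xr f f))%:E.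
Proof.
move=> intf; rewrite /L2norm unlock /inner /Rintegral.
rewrite [X in (X `^ _)%E](_ : _ =
    \int[lebesgue_measure]_(x in `]xl, xr[) (f x * f x)%:E)%E; last first.
  rewrite [RHS]integral_mkcond; apply: eq_integral => x _ /=.
  rewrite /patch; case: ifP => _ /=; last by rewrite normr0 powR0.
  by rewrite powR_mulrn// real_normK ?num_real// expr2.
rewrite -[X in (X `^ _)%E]fineK; last exact: integrable_fin_num intf.
rewrite poweR_EFin powR12_sqrt// fine_ge0// integral_ge0// => x _.
by rewrite lee_fin -expr2 sqr_ge0.
Qed.

Lemma L2norm_orthonormal_sum (phi : nat -> R -> R) (c : nat -> R) (m n : nat) :
  orthonormal_basis xl xr phi -> (1 <= m)%N ->
  L2norm xl xr (fun x => \sum_(m <= k < n) c k * phi k x) =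
  (Num.sqrt (\sum_(m <= k < n) c k ^+ 2))%:E.
Proof.
case=> phi2 orth _ m1.
have pos k : k \in index_iota m n -> (1 <= k)%N.
  by rewrite mem_index_iota => /andP[/(leq_trans m1)].
pose F j k x := c j * c k * (phi j x * phi k x).
have sqE x : (\sum_(m <= k < n) c k * phi k x) * (\sum_(m <= k < n) c k * phi k x)
    = \sum_(m <= j < n) \sum_(m <= k < n) F j k x.
  rewrite mulr_suml; apply: eq_bigr => j _; rewrite mulr_sumr.
  by apply: eq_bigr => k _; rewrite /F mulrACA.
have intF j k : j \in index_iota m n -> k \in index_iota m n ->
    (@lebesgue_measure R).-integrable `]xl, xr[ (EFin \o F j k).
  move=> /pos j1 /pos k1.
  have := integrableZl _ (c j * c k) (inL2_mul_integrable (phi2 _ j1) (phi2 _ k1)).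
  exact.
have intS j : j \in index_iota m n ->
    (@lebesgue_measure R).-integrable `]xl, xr[
      (EFin \o (fun x => \sum_(m <= k < n) F j k x)).
  move=> jr; rewrite (_ : _ \o _ =
     fun x => (\sum_(k <- index_iota m n | k \in index_iota m n) (F j k x)%:E)%E).
    by apply: integrable_sum => // k kr; exact: intF.
  by apply/funext => x /=; rewrite -big_seq sumEFin.
rewrite L2normE; last first.
  rewrite (_ : _ \o _ =
     fun x => (\sum_(j <- index_iota m n | j \in index_iota m n)
                 (\sum_(m <= k < n) F j k x)%:E)%E).
    by apply: integrable_sum => // j jr; exact: intS.
  by apply/funext => x /=; rewrite -big_seq sumEFin sqE.
congr (Num.sqrt _)%:E; rewrite /inner.
under eq_Rintegral do rewrite sqE.
rewrite Rintegral_sum//; apply: eq_big_seq => j jr.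
rewrite Rintegral_sum//; last by move=> k; exact: intF.
(* In row j of the double sum only the diagonal entry survives, by orthogonality. *)
rewrite (bigD1_seq j)//= ?iota_uniq// big1_seq ?addr0.
  rewrite RintegralZl//; last by apply: inL2_mul_integrable; apply: phi2; exact: pos.
  by rewrite -/(inner xl xr _ _) orth ?pos// eqxx mulr1 expr2.
move=> k /andP[kj kr].
rewrite RintegralZl//; last by apply: inL2_mul_integrable; apply: phi2; exact: pos.
by rewrite -/(inner xl xr _ _) orth ?pos// eq_sym (negbTE kj) mulr0.
Qed.

End orthonormal_combination.

(** * Integrals of decaying exponentials over a half-line *)

Section exponential_tail.
Context {R : realType}.
Implicit Types c p : R.

Let continuous_tail c : continuous (fun q : R => expR (c - q)).
Proof.
move=> x; apply: continuous_comp; last exact: continuous_expR.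
by apply: continuousB; [exact: cvg_cst|exact: cvg_id].
Qed.

Lemma integral_expR_tail c p :
  (\int[lebesgue_measure]_(q in `]p, +oo[) (expR (c - q))%:E
   = (expR (c - p))%:E)%E.
Proof.
(* Adding the end point p, a null set, gives the closed half-line on which the fundamental theorem
   of calculus applies, with antiderivative -e^(c - q) and limit 0 at infinity. *)
rewrite integral_itv_obnd_cbnd; last first.
  apply/measurable_EFinP; apply: measurable_funTS.
  exact: continuous_measurable_fun.
have dF x : is_derive x (1 : R) (fun q => - expR (c - q)) (expR (c - x)).
  by apply: is_derive_eq; rewrite add0r mul1r mulrN1 opprK.
rewrite (@ge0_continuous_FTC2y _ _ (fun q => - expR (c - q)) _ 0).
- by rewrite -EFinB sub0r opprK.
- by move=> x _; exact: expR_ge0.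
- exact: continuous_subspaceT.
- rewrite -oppr0; apply: cvgN.
  rewrite (_ : (fun q => _) = fun q => expR c * expR (- q)); last first.
    by apply/funext => q; rewrite expRD.
  by rewrite -[X in _ --> X](mulr0 (expR c)); apply: cvgMr; exact: cvgr_expR.
- by move=> x _; apply: ex_derive; exact: dF.
- by apply: cvg_at_right_filter; apply: cvgN; exact: continuous_tail.
- by move=> x _; rewrite derive1E; apply: derive_val; exact: dF.
Qed.

Lemma integrable_expR_tail c p :
  (@lebesgue_measure R).-integrable `]p, +oo[ (EFin \o (fun q => expR (c - q))).
Proof.
apply/integrableP; split.
  apply/measurable_EFinP; apply: measurable_funTS.
  exact: continuous_measurable_fun.
under eq_integral do rewrite /= ger0_norm ?expR_ge0//.
by rewrite integral_expR_tail ltry.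
Qed.

End exponential_tail.

(** The partial sums are constant from n on, so the limit that defines the series really exists and
    is not a default value. *)
Lemma series_eventually0 (R : realType) (f : nat -> R) (m n : nat) :
  (m <= n)%N -> (forall k, (n <= k)%N -> f k = 0) ->
  \big[+%R/0]_(m <= k <oo) f k = \sum_(m <= k < n) f k.
Proof.
move=> mn f0; apply: lim_near_cst; first exact: norm_hausdorff.
near=> N; have nN : (n <= N)%N by near: N; exact: nbhs_infty_ge.
rewrite (big_cat_nat mn nN)/= [X in _ + X]big_nat_cond.
by rewrite [X in _ + X]big1 ?addr0// => k /andP[/andP[/f0]].
Unshelve. all: by end_near. Qed.

(** * Recovery formulas and the spectral tail *)

Section recovery.
Context {R : realType} (xl xr : R) (phi : nat -> R -> R) (lambda : nat -> R).
Context (T : R) (uT : R -> R).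
Context (lambda1_gt0 : 0 < lambda 1%N).
Context (lambda_le : forall j k, (1 <= j)%N -> (j <= k)%N -> lambda j <= lambda k).

Local Notation coef := (coef xl xr phi lambda T uT).

Lemma lambda_gt0 k : (1 <= k)%N -> 0 < lambda k.
Proof. by move=> k1; exact: lt_le_trans (lambda_le _ k1). Qed.

(** Moves every mode to time 0, where [delta] is measured. *)
Lemma coef_decay t k : coef t k = expR (- lambda k * t) * coef 0 k.
Proof.
by rewrite /Defs.coef mulrA -expRD subr0 mulrBr mulNr addrC.
Qed.

(** One threshold serves all times and all retained modes, since 0 <= T - t <= T and [lambda] is
    nondecreasing. *)
Let frequency_le n t k p : 0 <= t <= T -> (1 <= k <= n)%N ->
  lambda n * T < p -> lambda k * (T - t) <= p.
Proof.
move=> /andP[t0 tT] /andP[k1 kn] /ltW; apply: le_trans.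
apply: ler_pM; first exact/ltW/lambda_gt0.
- by rewrite subr_ge0.
- exact: lambda_le.
- by rewrite gerBl.
Qed.

Lemma recover_pointwiseE n t x p : 0 <= t <= T -> lambda n * T < p ->
  recover_pointwise xl xr phi lambda T uT n t x p =
  \sum_(1 <= k < n.+1) coef t k * phi k x.
Proof.
move=> tT np; rewrite /recover_pointwise /warped mulr_sumr.
apply: eq_big_nat => k kn; rewrite ger0_norm ?subr_ge0 ?(frequency_le tT kn)//.
by rewrite !mulrA -expRD opprB addrC subrK.
Qed.

Lemma recover_integralE n t x p : 0 <= t <= T -> lambda n * T < p ->
  recover_integral xl xr phi lambda T uT n t x p =
  \sum_(1 <= k < n.+1) coef t k * phi k x.
Proof.
move=> tT np; rewrite /recover_integral.
pose F k q := inner xl xr uT (phi k) * phi k x * expR (lambda k * (T - t) - q).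
have intF k : (@lebesgue_measure R).-integrable `]p, +oo[ (EFin \o F k).
  have := integrableZl _ (inner xl xr uT (phi k) * phi k x)
            (integrable_expR_tail (lambda k * (T - t)) p).
  exact.
have -> : \int[lebesgue_measure]_(q in `]p, +oo[)
      warped xl xr phi lambda T uT n t x q =
    \int[lebesgue_measure]_(q in `]p, +oo[) \sum_(1 <= k < n.+1) F k q.
  apply: eq_Rintegral => q; rewrite inE/= in_itv/= andbT => pq; apply: eq_big_nat => k kn.
  rewrite ger0_norm ?subr_ge0 ?(frequency_le tT kn (lt_trans np pq))//.
  by rewrite opprB /F -mulrA mulrC.
rewrite Rintegral_sum// mulr_sumr; apply: eq_bigr => k _.
rewrite /F RintegralZl//; last exact: integrable_expR_tail.
rewrite [X in _ * (_ * X)](_ : _ = expR (lambda k * (T - t) - p)); last first.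
  by rewrite /Rintegral integral_expR_tail.
by rewrite /Defs.coef mulrCA -expRD addrC subrK mulrC mulrA.
Qed.

Lemma coef_tail_le s n M t : 0 <= s -> (1 <= n)%N -> 0 <= t ->
  \sum_(n.+1 <= k < M) coef t k ^+ 2 <=
  expR (- lambda n * t) ^+ 2 / lambda n `^ s *
  \sum_(n <= k < M) (`|coef 0 k| ^+ 2 * lambda k `^ s).
Proof.
move=> s0 n1 t0; have ln0 := lambda_gt0 n1.
have [Mn|nM] := leqP M n.
  by rewrite !big_geq ?mulr0// (leq_trans Mn).
(* The error starts at n + 1 while [delta] starts at n; the extra term k = n on the right is
   nonnegative and is dropped. *)
rewrite [X in _ * X]big_ltn// mulrDr -[leLHS]add0r lerD//.
  by rewrite mulr_ge0// ?divr_ge0 ?sqr_ge0 ?powR_ge0// mulr_ge0 ?sqr_ge0 ?powR_ge0.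
rewrite mulr_sumr; apply: ler_sum_nat => k /andP[nk _].
have lnk : lambda n <= lambda k by apply: lambda_le => //; exact: ltnW.
rewrite coef_decay exprMn real_normK ?num_real//.
rewrite [leLHS]mulrC [leRHS]mulrCA ler_wpM2l ?sqr_ge0//.
(* The factors are compared separately: the exponentials using t >= 0, then 1 <= (lambda_k /
   lambda_n)^s using s >= 0. *)
rewrite -mulrA -[leLHS]mulr1 ler_pM ?sqr_ge0//.
  rewrite ler_sqr ?nnegrE ?expR_ge0// ler_expR !mulNr lerN2.
  by rewrite ler_wpM2r.
rewrite mulrC ler_pdivlMr ?powR_gt0// mul1r ge0_ler_powR// nnegrE ltW//.
exact: lt_le_trans lnk.
Qed.

End recovery.

Theorem theorem3p3 (R : realType) (xl xr : R) (a : R -> R) (alpha0 : R)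
    (phi : nat -> R -> R) (lambda : nat -> R) (T s : R) (uT : R -> R)
    (u : R -> R -> R) (nmax : nat) (unmax : R -> R -> R -> R) (eps : R) :
  xl < xr ->
  smooth_closed xl xr a ->
  0 < alpha0 ->
  (forall x, x \in `[xl, xr] -> alpha0 <= a x) ->
  orthonormal_basis xl xr phi ->
  (forall k, (1 <= k)%N -> dirichlet_eigenfunction xl xr a (lambda k) (phi k)) ->
  0 < lambda 1%N ->
  (forall j k, (1 <= j)%N -> (j <= k)%N -> lambda j <= lambda k) ->
  lambda k @[k --> \oo] --> +oo ->
  0 < T ->
  s \is a Num.nat \/ 1 <= s <= 2 ->
  inHs xl xr phi lambda s uT ->
  finite_set [set k : nat | (1 <= k)%N /\ inner xl xr uT (phi k) != 0] ->
  (forall t x, 0 <= t <= T -> x \in `[xl, xr] ->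
    u t x = expansion xl xr phi lambda T uT t x) ->
  backward_solution xl xr a T uT u ->
  (1 <= nmax)%N ->
  (forall t x p, 0 <= t <= T -> x \in `]xl, xr[ -> lambda nmax * T < p ->
     unmax t x p = recover_pointwise xl xr phi lambda T uT nmax t x p) \/
  (forall t x p, 0 <= t <= T -> x \in `]xl, xr[ -> lambda nmax * T < p ->
     unmax t x p = recover_integral xl xr phi lambda T uT nmax t x p) ->
  0 < eps ->
  delta xl xr phi lambda T uT s nmax / lambda nmax `^ (s / 2) <= eps ->
  forall t p, 0 <= t < T -> lambda nmax * T < p ->
    (L2norm xl xr (fun x => (u t x - unmax t x p)%R)
       <= (expR (- lambda nmax * t) * delta xl xr phi lambda T uT s nmax
           / lambda nmax `^ (s / 2))%:E)%E
    /\ expR (- lambda nmax * t) * delta xl xr phi lambda T uT s nmax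
         / lambda nmax `^ (s / 2) <= eps.
Proof.
move=> _ _ _ _ basis _ l1 lle _ _ sP _ fin uE _ n1 uP _ small t p /andP[t0 tT] np.
have s0 : 0 <= s by case: sP => [/natr_ge0//|/andP[/(le_trans ler01)]].
have ln0 : 0 < lambda nmax by exact: lambda_gt0 lle _ n1.
have tT' : 0 <= t <= T by rewrite t0 ltW.
have unE x : x \in `]xl, xr[ -> unmax t x p =
    \sum_(1 <= k < nmax.+1) coef xl xr phi lambda T uT t k * phi k x.
  move=> xO; case: uP => ->//; first exact: recover_pointwiseE.
  exact: recover_integralE.
(* N is one more than the largest index k >= 1 with a nonzero coefficient; index 0 is excluded
   because the hypothesis says nothing about it. *)
have [N N0] : exists N, forall k, (N <= k)%N -> (1 <= k)%N ->
    inner xl xr uT (phi k) = 0.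
  have /finite_seqP[X XE] := fin.
  exists (\max_(k <- X) k).+1 => k Nk k1; apply/eqP/negPn/negP => k0.
  have kX : k \in X by have : [set` X] k by rewrite -XE.
  by move: Nk; rewrite ltnNge (leq_bigmax_seq k kX).
(* Beyond M all coefficients vanish, so both [expansion] and [delta] become sums up to M; M > nmax
   allows the former to be split after nmax. *)
pose M := maxn N nmax.+1.
have NM k : (M <= k)%N -> inner xl xr uT (phi k) = 0.
  rewrite geq_max => /andP[/N0 Nk nk]; apply: Nk.
  exact: leq_trans nk.
have nM : (nmax < M)%N by rewrite leq_max leqnn orbT.
have uE' x : x \in `]xl, xr[ -> u t x =
    \sum_(1 <= k < M) coef xl xr phi lambda T uT t k * phi k x.
  move=> xO; rewrite uE//; last exact: subset_itv_oo_cc.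
  apply: series_eventually0 => [|k /NM]; first exact: leq_trans nM.
  by rewrite /coef => ->; rewrite mulr0 mul0r.
have deltaE : delta xl xr phi lambda T uT s nmax =
    Num.sqrt (\sum_(nmax <= k < M)
                (`|coef xl xr phi lambda T uT 0 k| ^+ 2 * lambda k `^ s)).
  congr Num.sqrt; apply: series_eventually0 => [|k /NM]; first exact: ltnW.
  by rewrite /coef => ->; rewrite mulr0 normr0 expr0n mul0r.
split; last first.
  (* The second bound only uses e^(-lambda_nmax t) <= 1. *)
  apply: le_trans small; rewrite -mulrA ler_piMl//.
    by rewrite divr_ge0 ?powR_ge0// /delta sqrtr_ge0.
  by rewrite -expR0 ler_expR mulNr oppr_le0 mulr_ge0// ltW.
have -> : L2norm xl xr (fun x => u t x - unmax t x p) =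
    L2norm xl xr (fun x => \sum_(nmax.+1 <= k < M)
                             coef xl xr phi lambda T uT t k * phi k x).
  (* Outside the open interval both restricted functions are 0, so the formulas for u and [unmax]
     are needed only inside. *)
  apply: eq_Lnorm => x /=; rewrite /patch; case: ifPn => //; rewrite inE/= => xO.
  rewrite uE'// unE// (big_cat_nat (n := nmax.+1))//=.
  by rewrite addrAC subrr add0r.
rewrite L2norm_orthonormal_sum// lee_fin.
set X := (X in _ <= X).
have X0 : 0 <= X.
  by rewrite /X divr_ge0 ?powR_ge0// mulr_ge0 ?expR_ge0// /delta sqrtr_ge0.
(* Writing X as the square root of X^2 reduces the claim to squares, where (lambda_nmax^(s/2))^2 =
   lambda_nmax^s matches the tail estimate. *)
rewrite -[leRHS]ger0_norm// -sqrtr_sqr ler_sqrt ?sqr_ge0//.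
apply: le_trans (@coef_tail_le _ xl xr phi _ T uT l1 lle _ _ M _ s0 n1 t0) _.
rewrite /X deltaE !exprMn sqr_sqrtr; last first.
  by apply: sumr_ge0 => k _; rewrite mulr_ge0 ?powR_ge0 ?sqr_ge0.
rewrite exprVn -(powR_mulrn 2 (powR_ge0 (lambda nmax) _)) -powRrM.
by rewrite divfK// [leLHS]mulrAC.
Qed.
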